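(* Let $X$ be a compact metric space and let $F\subset X\times X$ be a closed relation on $X$. Then $F$ is CR-turbulent if and only if there is $n\in\mathbb{N}$, $n\ge 2$, such that the dynamical system $(X_F^+,(\sigma_F^+)^{n-1})$ is separated turbulent.
   Context: $\mathbb{N}$ denotes the positive integers. A closed relation on $X$ is a closed subset of $X\times X$. For a closed relation $F$ on $X$ and $m\in\mathbb{N}$, $X_F^m=\{(x_1,\dots,x_{m+1})\in X^{m+1}: (x_i,x_{i+1})\in F \text{ for } 1\le i\le m\}$, and $X_F^+=\{(x_1,x_2,\dots)\in\prod_{i=1}^\infty X: (x_i,x_{i+1})\in F \text{ for all } i\in\mathbb{N}\}$ (product topology). The shift map $\sigma_F^+:X_F^+\to X_F^+$ is $\sigma_F^+(x_1,x_2,\dots)=(x_2,x_3,\dots)$. $\pi_i$ is the projection to the $i$-th coordinate. $F$ is CR-turbulent if there are $n\in\mathbb{N}$ and two disjoint nonempty closed sets $K,L\subset X_F^n$ such that $\pi_1(K)\cup\pi_1(L)\subset\pi_{n+1}(K)\cap\pi_{n+1}(L)$ (here $\pi_{n+1}$ is the last coordinate of points of $X_F^n\subset X^{n+1}$). A dynamical system $(Z,f)$ ($Z$ compact metric, $f:Z\to Z$ continuous) is separated turbulent if there are disjoint nonempty closed sets $K,L\subset Z$ with $K\cup L\subset f(K)\cap f(L)$. *)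

(* Defs.v *)
From HB Require Import structures.
From mathcomp Require Import all_boot all_order all_algebra.
From mathcomp Require Import all_classical all_reals all_analysis.

Set Implicit Arguments.
Unset Strict Implicit.
Unset Printing Implicit Defensive.

Local Open Scope classical_set_scope.

Section Mahavier.
Context {X : topologicalType}.
Implicit Type F : set (X * X).

(* Coordinates are numbered from 0: [x ord0] and [x ord_max] are the first and
   the (m+1)-st coordinate of x in X^(m+1).  [{ptws _ -> X}] carries the product
   topology, and a set used as a type carries the subspace topology. *)
Definition mahavier F (m : nat) : set {ptws 'I_m.+1 -> X} :=
  [set x | forall i : 'I_m, F (x (widen_ord (leqnSn m) i), x (lift ord0 i))].

Arguments mahavier F m : clear implicits.

Definition mahavier_inf F : set {ptws nat -> X} :=
  [set x | forall i : nat, F (x i, x i.+1)].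

Definition fst_coord F m (x : mahavier F m) : X := set_val x ord0.

Definition last_coord F m (x : mahavier F m) : X := set_val x ord_max.

Lemma shift_map_subproof F (x : mahavier_inf F) :
  (fun i : nat => set_val x i.+1) \in mahavier_inf F.
Proof. by apply/mem_set => i; exact: (set_valP x). Qed.

Definition shift_map F (x : mahavier_inf F) : mahavier_inf F :=
  exist _ (fun i : nat => set_val x i.+1) (shift_map_subproof x).

Definition CR_turbulent F : Prop :=
  exists n : nat, (0 < n)%N /\
  exists K L : set (mahavier F n),
    [/\ closed K, closed L, K !=set0, L !=set0 & K `&` L = set0] /\
    (@fst_coord F n @` K) `|` (@fst_coord F n @` L)
      `<=` (@last_coord F n @` K) `&` (@last_coord F n @` L).

End Mahavier.

(* Compact metric spaces are rendered as compact Hausdorff pseudometric spaces;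
   the library puts a pseudometric structure on countable products and on
   subsets of pseudometric spaces. *)
Definition dynamical_system {R : realType} {Z : pseudoMetricType R}
    (f : Z -> Z) : Prop :=
  [/\ hausdorff_space Z, compact [set: Z] & continuous f].

Definition separated_turbulent {Z : topologicalType} (f : Z -> Z) : Prop :=
  exists K L : set Z,
    [/\ closed K, closed L, K !=set0, L !=set0 & K `&` L = set0] /\
    K `|` L `<=` (f @` K) `&` (f @` L).

Lemma compact_set_type {T : topologicalType} (A : set T) :
  compact A -> compact [set: A].
Proof.
move=> cA G PG _.
have GA : (set_val @ G) A.
  by apply: (@filterE _ G) => x; exact: set_valP.
have [p [Ap clp]] := cA (set_val @ G) _ GA.
exists (exist _ p (mem_set Ap)); split => // B U GB [V [[W oW <-] Wp] VU].
have [q [[b Bb <-] Wb]] : (set_val @` B) `&` W !=set0.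
  apply: clp; last exact: open_nbhs_nbhs.
  by apply: (@filterS _ G _ _ _ _ GB) => b Bb; exists b.
by exists b; split => //; exact: VU.
Qed.

Lemma hausdorff_set_type {T : topologicalType} (A : set T) :
  hausdorff_space T -> hausdorff_space A.
Proof.
move=> hT p q clpq; apply: val_inj; apply: hT => U V Up Vq.
have [r [Ur Vr]] := clpq _ _ (@initial_continuous A T set_val p _ Up)
  (@initial_continuous A T set_val q _ Vq).
by exists (set_val r).
Qed.

Lemma continuous_pair {T U V : topologicalType} (f : T -> U) (g : T -> V) :
  continuous f -> continuous g -> continuous (fun x => (f x, g x)).
Proof. by move=> cf cg x; apply: cvg_pair; [exact: cf|exact: cg]. Qed.

Section MahavierTopology.
Context {X : topologicalType} (F : set (X * X)).

Lemma continuous_coord (i : nat) :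
  continuous (fun x : {ptws nat -> X} => x i).
Proof. exact: proj_continuous. Qed.

Lemma closed_mahavier_inf : closed F -> closed (mahavier_inf F).
Proof.
move=> cF; rewrite (_ : mahavier_inf F =
    \bigcap_i ((fun x : {ptws nat -> X} => (x i, x i.+1)) @^-1` F)).
  apply: (@closed_bigI {ptws nat -> X}) => i _.
  apply: (@preimage_closed {ptws nat -> X}) cF => x _.
  by apply: continuous_pair; exact: continuous_coord.
by apply/seteqP; split => [x Fx i _|x Fx i]; [exact: Fx|exact: (Fx i)].
Qed.

Lemma compact_mahavier_inf :
  compact [set: X] -> closed F -> compact (mahavier_inf F).
Proof.
move=> cX /closed_mahavier_inf cF.
apply: (subclosed_compact cF (@tychonoff nat (fun=> X) (fun=> setT) (fun=> cX))).
by move=> x _ i.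
Qed.

Lemma continuous_to_ptws {T : topologicalType} (f : T -> {ptws nat -> X}) :
  (forall i, continuous (fun t => f t i)) -> continuous f.
Proof.
move=> cf x; apply/cvg_sup.
move=> i; move: x.
apply/(@continuousP _ (initial_topology (@^~ i))) => _ [B oB <-].
by move/continuousP: (cf i) => /(_ B oB).
Qed.

Lemma continuous_shift_map : continuous (@shift_map X F).
Proof.
apply: continuous_comp_initial; apply: continuous_to_ptws => i x.
apply: (@continuous_comp _ {ptws nat -> X} _ set_val (fun y => y i.+1)).
  exact: initial_continuous.
exact: continuous_coord.
Qed.

End MahavierTopology.

Lemma shift_map_dynamical_system {R : realType} {X : metricType R}
    (F : set (X * X)) (k : nat) : compact [set: X] -> closed F ->
  dynamical_system (iter k (@shift_map X F)).
Proof.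
move=> cX cF; split.
- apply: hausdorff_set_type; apply: hausdorff_product => _.
  exact: metric_hausdorff.
- exact/compact_set_type/compact_mahavier_inf.
- elim: k => [|k IHk] x; first exact: cvg_id.
  by apply: continuous_comp; [exact: IHk|exact: continuous_shift_map].
Qed.

(* Main.v *)
Require Import Defs.
From mathcomp Require Import all_boot all_order all_algebra.
From mathcomp Require Import all_classical all_reals all_analysis.

(** Both notions of turbulence say that a finite path ending at a prescribed
    point can be chosen in either of two disjoint closed families; they differ
    only in whether the families consist of finite or of infinite paths.  The
    translation costs nothing in the number of shift iterations from finite to
    infinite, but may require many iterations from infinite to finite.

    From finite to infinite, let [K] and [L] be closed sets of [F]-paths with
    [n] steps.  Take the infinite [F]-paths that are concatenations of elements
    of [K `|` L], consecutive ones overlapping in one point, and sort out those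
    whose first piece is in [K], respectively in [L].  Any such concatenation
    starts at the first point of some piece, which is by hypothesis the last
    point of an element of [K] and of an element of [L]; so it can be prolonged
    to the left by a piece of either kind, and [n] shifts undo the prolongation.
    The hypothesis allows prolongation to the left only, so the existence of an
    infinite concatenation is not immediate: it comes from compactness, by
    producing arbitrarily long finite concatenations and taking a cluster
    point ([exists_infinite_concatenation]).

    From infinite to finite, let [K] and [L] be closed sets of infinite
    [F]-paths that turn [shift ^ m] into a separated turbulent map.  The natural
    candidates are the sets of initial segments of paths in [K] and [L].  Since
    [K] and [L] are disjoint and compact, some number [k] of coordinates
    suffices to tell any path of [K] from any path of [L]
    ([eventually_disjoint_initial_blocks]), but [m] itself may be too small for
    that.  The covering property passes to all iterates of [shift ^ m]
    ([subset_iter_image]), so segments whose length is a multiple of [m]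
    exceeding [k] do the job. *)

Local Open Scope classical_set_scope.

(** * Compactness and closed sets *)

(** The finite intersection property, for countably many closed sets.  It is
    used both to build an infinite concatenation of paths and to find how many
    coordinates distinguish two disjoint compact sets of sequences. *)
Lemma compact_finite_intersections {T : topologicalType} (A : set T)
    (C : nat -> set T) :
  compact A -> (forall j, closed (C j)) ->
  (forall k, exists2 x, A x & forall j, (j < k)%N -> C j x) ->
  exists2 p, A p & forall j, C j p.
Proof.
move=> cA cC AC; have {AC}/choice[u /all_and2[Au Cu]] k :
    exists x, A x /\ forall j, (j < k)%N -> C j x.
  by have [x Ax Cx] := AC k; exists x.
have [p [Ap clp]] : A `&` cluster (u @ \oo) !=set0.
  by apply: cA; exists 0%N => // k _; exact: Au.
exists p => // j; apply: cC => B Bp.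
by apply: clp => //; exists j.+1 => // k /= jk; exact: Cu.
Qed.

Lemma closed_eq_fun {T X : topologicalType} (f g : T -> X) :
  hausdorff_space X -> continuous f -> continuous g ->
  closed [set t | f t = g t].
Proof.
move=> hX cf cg t clt; apply: hX => U V Uf Vg.
have [s [/= fgs [Us Vs]]] : [set t | f t = g t] `&` (f @^-1` U `&` g @^-1` V) !=set0.
  by apply: clt; apply: filterI; [exact: cf|exact: cg].
by exists (f s); split => //; rewrite fgs.
Qed.

(** A set of paths is closed relative to the space of all [F]-paths; this makes
    it closed in the full product, where the cluster points are taken. *)
Lemma closed_set_val_image {T : topologicalType} (A : set T) (K : set A) :
  closed A -> closed K -> closed (set_val @` K).
Proof.
move=> cA /closed_openC[U oU UK].
rewrite (_ : set_val @` K = A `&` ~` U).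
  by apply: closedI => //; exact: open_closedC.
have inU (a : A) : U (set_val a) = ~ K a.
  by rewrite -[RHS]/((~` K) a) -UK.
apply/seteqP; split => [_ [a Ka <-]|x [Ax Ux]].
  by split; [exact: set_valP|move=> /=; rewrite inU; apply].
exists (exist _ x (mem_set Ax)) => //; apply: contrapT => nK.
by apply: Ux; move: nK; rewrite -inU.
Qed.

Lemma continuous_ptws {T X : topologicalType} {I : eqType}
    (f : T -> {ptws I -> X}) :
  (forall i, continuous (fun t => f t i)) -> continuous f.
Proof.
move=> cf x; apply/cvg_sup => i; move: x.
apply/(@continuousP _ (initial_topology (@^~ i))) => _ [B oB <-].
by move/continuousP: (cf i) => /(_ B oB).
Qed.

(** * Blocks of sequences and prolongation to the left *)

Definition block {X : topologicalType} (n i : nat) (x : {ptws nat -> X}) :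
  {ptws 'I_n.+1 -> X} := fun j => x (i + j)%N.

(** The last point of [w] is dropped, because it is meant to be the first point
    of [y]. *)
Definition prepend {X : topologicalType} {n : nat} (w : {ptws 'I_n.+1 -> X})
    (y : {ptws nat -> X}) : {ptws nat -> X} :=
  fun i => if (i < n)%N then w (inord i) else y (i - n)%N.

Lemma continuous_block {X : topologicalType} (n i : nat) :
  continuous (@block X n i).
Proof. by apply: continuous_ptws => j; exact: continuous_coord. Qed.

Lemma block0_prepend {X : topologicalType} {n : nat}
    (w : {ptws 'I_n.+1 -> X}) (y : {ptws nat -> X}) :
  w ord_max = y 0%N -> block n 0 (prepend w y) = w.
Proof.
move=> wy; apply/funext => j; rewrite /block /prepend add0n.
case: ltnP => [_|nj]; first by rewrite inord_val.
have -> : j = ord_max by apply/val_inj/eqP; rewrite eqn_leq nj -ltnS ltn_ord.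
by rewrite subnn.
Qed.

Lemma shift_prepend {X : topologicalType} {n : nat}
    (w : {ptws 'I_n.+1 -> X}) (y : {ptws nat -> X}) i :
  prepend w y (n + i)%N = y i.
Proof. by rewrite /prepend ltnNge leq_addr addKn. Qed.

Lemma block_prepend {X : topologicalType} {n : nat}
    (w : {ptws 'I_n.+1 -> X}) (y : {ptws nat -> X}) m i :
  block m (n + i) (prepend w y) = block m i y.
Proof.
by apply/funext => j; rewrite /block -addnA shift_prepend.
Qed.

Lemma mahavier_block {X : topologicalType} (F : set (X * X)) n i x :
  mahavier_inf F x -> mahavier F (block n i x).
Proof. by move=> Fx j; rewrite /block /= /bump /= add1n addnS. Qed.

(** The blocks starting at multiples of [n] have [n] steps, so together they
    contain every step of the sequence: step [i] is step [i %% n] of block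
    [i %/ n]. *)
Lemma mahavier_inf_blocks {X : topologicalType} (F : set (X * X)) n x :
  (0 < n)%N -> (forall j, mahavier F (block n (j * n) x)) -> mahavier_inf F x.
Proof.
move=> n0 Fx i; have /= := Fx (i %/ n)%N (Ordinal (ltn_pmod i n0)).
by rewrite /block /= /bump /= add1n addnS -divn_eq.
Qed.

Lemma closed_mahavier {X : topologicalType} (F : set (X * X)) n :
  closed F -> closed (@mahavier X F n).
Proof.
move=> cF; rewrite (_ : @mahavier X F n = \bigcap_i
    ((fun x : {ptws 'I_n.+1 -> X} =>
        (x (widen_ord (leqnSn n) i), x (lift ord0 i))) @^-1` F)).
  apply: closed_bigI => i _; apply: (preimage_closed _ cF) => x _.
  by apply: continuous_pair; exact: proj_continuous.
by apply/seteqP; split => [x Fx i _|x Fx i]; [exact: Fx|exact: (Fx i)].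
Qed.

Lemma iter_shift_mapE {X : topologicalType} {F : set (X * X)} k
    (x : mahavier_inf F) i :
  set_val (iter k (@shift_map X F) x) i = set_val x (k + i)%N.
Proof. by elim: k i => // k IHk i; rewrite addSnnS -IHk. Qed.

(** * From finite paths to infinite paths *)

(** Pieces can only be added on the left, so for each [k] one obtains a sequence
    whose first [k] blocks are in [B], but these sequences do not extend one
    another.  The sequences whose [j]-th block is in [B] form a closed set, and
    compactness gives a sequence in all of these sets. *)
Lemma exists_infinite_concatenation {X : topologicalType} n
    (B : set {ptws 'I_n.+1 -> X}) :
  compact [set: X] -> closed B -> B !=set0 ->
  (forall w, B w -> exists2 v, B v & v ord_max = w ord0) ->
  exists x, forall j, B (block n (j * n) x).
Proof.
move=> cX cB [w0 Bw0] Bl.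
have cXN : compact [set x : {ptws nat -> X} | nat -> [set: X] (x 0%N)].
  have := @tychonoff nat (fun=> X) (fun=> setT) (fun=> cX).
  by congr compact; apply/seteqP; split.
have chain k : exists2 x : {ptws nat -> X}, (exists2 w, B w & w ord0 = x 0%N) &
    forall j, (j < k)%N -> B (block n (j * n) x).
  (* The condition on the first point of [x], which must be the first point of
     an element of [B], is what allows one more piece to be prepended. *)
  elim: k => [|k [x [w Bw wx] Bx]]; 
    first by exists (fun=> w0 ord0) => //; exists w0.
  have [v Bv vw] := Bl _ Bw.
  have vx : block n 0 (prepend v x) = v by apply: block0_prepend; rewrite vw.
  exists (prepend v x); first by exists v => //; rewrite -[in LHS]vx.
  by case=> [_|j jk]; [rewrite mul0n vx|rewrite mulSn block_prepend; exact: Bx].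
have [x _ Bx] : exists2 x : {ptws nat -> X}, nat -> [set: X] (x 0%N) &
    forall j, B (block n (j * n) x).
  apply: (@compact_finite_intersections _ _
    (fun j => block n (j * n) @^-1` B) cXN) => [j|k].
    by apply: (preimage_closed _ cB) => x _; exact: continuous_block.
  by have [x _ Bx] := chain k; exists x.
by exists x.
Qed.

(** The turbulent pair consists of the concatenations of elements of [K `|` L]
    with first piece in [K], respectively in [L].  The covering property even
    gives nonemptiness: prolonging one concatenation by an element of [K] and by
    an element of [L] yields a point of each set. *)
Lemma CR_turbulent_shift {X : topologicalType} (F : set (X * X)) :
  compact [set: X] -> closed F -> CR_turbulent F ->
  exists2 n, (0 < n)%N & separated_turbulent (iter n (@shift_map X F)).
Proof.
move=> cX cF [n [n0 [K [L [[cK cL [w0 Kw0] _ KL0] KLsub]]]]].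
exists n => //.
(* Seen in the full product, the two sets of paths can be compared with blocks
   of arbitrary sequences, which need not be [F]-paths a priori. *)
pose Kw := set_val @` K; pose Lw := set_val @` L; pose B := Kw `|` Lw.
have cKw : closed Kw by apply: closed_set_val_image => //; exact: closed_mahavier.
have cLw : closed Lw by apply: closed_set_val_image => //; exact: closed_mahavier.
have cB : closed B by exact: closedU.
have BF w : B w -> mahavier F w by move=> [] [a _ <-]; exact: set_valP.
have Blast w : B w -> (exists2 v, Kw v & v ord_max = w ord0) /\
                      (exists2 v, Lw v & v ord_max = w ord0).
  move=> Bw; have /KLsub[[a Ka aw] [b Lb bw]] :
      (@fst_coord _ F n @` K `|` @fst_coord _ F n @` L) (w ord0).
    by case: Bw => -[a Ka <-]; [left|right]; exists a.
  by split; [exists (set_val a)|exists (set_val b)] => //;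
    [exists a|exists b].
pose Z (A : set {ptws 'I_n.+1 -> X}) : set (mahavier_inf F) :=
  [set x | A (block n 0 (set_val x))] `&`
  \bigcap_j [set x | B (block n (j * n) (set_val x))].
have cpre i (A : set {ptws 'I_n.+1 -> X}) : closed A ->
    closed [set x : mahavier_inf F | A (block n i (set_val x))].
  move=> cA; apply: (@preimage_closed (mahavier_inf F) _
    (block n i \o set_val) A _ cA) => x _.
  apply: continuous_comp; last exact: continuous_block.
  exact: initial_continuous.
have cZ A : closed A -> closed (Z A).
  by move=> cA; apply: closedI; [exact: cpre|apply: closed_bigI => j _; exact: cpre].
have Zcover A (y : mahavier_inf F) : A `<=` B ->
    (forall w, B w -> exists2 v, A v & v ord_max = w ord0) ->
    (forall j, B (block n (j * n) (set_val y))) ->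
    (iter n (@shift_map X F) @` Z A) y.
  move=> AB Alast By; have [v Av vy] := Alast _ (By 0%N).
  have vx : block n 0 (prepend v (set_val y)) = v.
    by apply: block0_prepend; rewrite vy /block mul0n.
  have Bx j : B (block n (j * n) (prepend v (set_val y))).
    case: j => [|j]; first by rewrite mul0n vx; exact: AB.
    by rewrite mulSn block_prepend.
  have Fx : mahavier_inf F (prepend v (set_val y)).
    by apply: (mahavier_inf_blocks _ _ _ n0) => j; exact: BF.
  exists (exist _ (prepend v (set_val y)) (mem_set Fx)).
    by split => [/=|j _ /=]; [rewrite vx|exact: Bx].
  apply/val_inj/funext => i.
  rewrite [LHS]iter_shift_mapE; exact: shift_prepend.
have KwB : Kw `<=` B by left.
have LwB : Lw `<=` B by right.
have Zsub y : (forall j, B (block n (j * n) (set_val y))) ->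
    ((iter n (@shift_map X F) @` Z Kw) `&` (iter n (@shift_map X F) @` Z Lw)) y.
  by move=> By; split; apply: Zcover => // w /Blast[].
have [x Bx] : exists x, forall j, B (block n (j * n) x).
  apply: exists_infinite_concatenation => //.
    by exists (set_val w0); left; exists w0.
  by move=> w /Blast[[v Kv vw] _]; exists v => //; left.
have Fx : mahavier_inf F x.
  by apply: (mahavier_inf_blocks _ _ _ n0) => j; exact: BF.
have [[a Za _] [b Zb _]] := Zsub (exist _ x (mem_set Fx)) Bx.
exists (Z Kw), (Z Lw); split.
  split; [exact: cZ|exact: cZ|by exists a|by exists b|].
  apply/seteqP; split => // z [[[u Ku uz] _] [[v Lv vz] _]].
  have uv : u = v by apply: val_inj; rewrite [LHS]uz [RHS]vz.
  by suff : (K `&` L) u; [rewrite KL0|split => //; rewrite uv].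
by move=> y [] [_ By]; apply: Zsub => j; exact: By.
Qed.

(** * From infinite paths to finite paths *)

(** Otherwise, for each [k] some pair in [K `*` L] agrees on its first [k]
    coordinates; these are closed conditions on a compact product, so some pair
    agrees everywhere and lies on the diagonal, against disjointness. *)
Lemma eventually_disjoint_initial_blocks {X : topologicalType} (F : set (X * X))
    (K L : set (mahavier_inf F)) :
  hausdorff_space X -> compact K -> compact L -> K `&` L = set0 ->
  exists k, forall x z, K x -> L z ->
    exists2 i, (i < k)%N & set_val x i != set_val z i.
Proof.
move=> hX cK cL KL0; apply: contrapT => /forallNP nsep.
pose C i : set (mahavier_inf F * mahavier_inf F) :=
  [set p | (set_val p.1 : nat -> X) i = (set_val p.2 : nat -> X) i].
have ccoord i : continuous (fun x : mahavier_inf F => (set_val x : nat -> X) i).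
  move=> x; apply: (@continuous_comp _ {ptws nat -> X} _ set_val (fun y => y i)).
    exact: initial_continuous.
  exact: continuous_coord.
have [[x z] [/= Kx Lz] xz] : exists2 p, (K `*` L) p & forall i, C i p.
  apply: (@compact_finite_intersections _ _ C (compact_setX cK cL)) => [i|k].
    apply: (@closed_eq_fun (mahavier_inf F * mahavier_inf F)%type X
      (fun p => (set_val p.1 : nat -> X) i)
      (fun p => (set_val p.2 : nat -> X) i)) => // p.
      by apply: (@continuous_comp _ _ _ fst (fun x : mahavier_inf F =>
        (set_val x : nat -> X) i)); [exact: cvg_fst|exact: ccoord].
    by apply: (@continuous_comp _ _ _ snd (fun x : mahavier_inf F =>
        (set_val x : nat -> X) i)); [exact: cvg_snd|exact: ccoord].
  apply: contrapT => nC; apply: (nsep k) => x z Kx Lz.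
  apply: contrapT => nxz; apply: nC; exists (x, z) => // i ik.
  by apply: contrapT => xzi; apply: nxz; exists i => //; exact/eqP.
have xzE : x = z by apply/val_inj/funext.
by suff : (K `&` L) x; [rewrite KL0|split => //; rewrite xzE].
Qed.

Lemma subset_iter_image {T : Type} (f : T -> T) (A B : set T) k :
  (0 < k)%N -> A `|` B `<=` (f @` A) `&` (f @` B) ->
  A `|` B `<=` (iter k f @` A) `&` (iter k f @` B).
Proof.
move=> + fAB; case: k => // k _.
elim: k => [|k IHk y /fAB[[a Aa ay] [b Bb yb]]]; first exact: fAB.
split.
  have [[c Ac ca] _] := IHk a (or_introl Aa).
  by exists c => //; rewrite iterS ca.
have [_ [c Bc cb]] := IHk b (or_intror Bb).
by exists c => //; rewrite iterS cb.
Qed.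

(** The turbulent pair consists of the initial segments with [N] steps of the
    elements of [K] and [L], for a multiple [N] of [m] that is large enough to
    separate them.  If [y] is in [K `|` L] and [y] is the [N]-th shift of [a],
    then the segment of [a] ends where [y] begins. *)
Lemma shift_CR_turbulent {X : topologicalType} (F : set (X * X)) m :
  hausdorff_space X -> compact [set: X] -> closed F -> (0 < m)%N ->
  separated_turbulent (iter m (@shift_map X F)) -> CR_turbulent F.
Proof.
move=> hX cX cF m0 [K [L [[cK cL [a0 Ka0] [b0 Lb0] KL0] KLsub]]].
have cZ : compact [set: mahavier_inf F].
  exact/compact_set_type/compact_mahavier_inf.
have {}cK : compact K by exact: subclosed_compact cK cZ _.
have {}cL : compact L by exact: subclosed_compact cL cZ _.
have [k sep] := eventually_disjoint_initial_blocks F K L hX cK cL KL0.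
(* [k.+1 * m] exceeds [k] since [m] is positive; it is hidden behind an equation
   because it occurs as a dimension in types. *)
have [N NE] : exists N, N = (k.+1 * m)%N by exists (k.+1 * m)%N.
have kN : (k < N)%N by rewrite NE -{1}[k.+1]muln1 leq_mul.
exists N; split; first exact: leq_ltn_trans kN.
pose word (x : mahavier_inf F) : @mahavier X F N :=
  exist _ (block N 0 (set_val x))
    (mem_set (mahavier_block F N 0 _ (set_valP x))).
have cword : continuous word.
  apply: continuous_comp_initial => x.
  apply: (@continuous_comp _ _ _ set_val (block N 0)); last exact: continuous_block.
  exact: initial_continuous.
have hN : hausdorff_space (@mahavier X F N).
  by apply: hausdorff_set_type; apply: hausdorff_product => _.
have cimg A : compact A -> closed (word @` A).
  move=> cA; apply: (compact_closed hN); apply: continuous_compact cA.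
  exact: continuous_subspaceT.
have KLN : K `|` L `<=` (iter N (@shift_map X F) @` K) `&`
                        (iter N (@shift_map X F) @` L).
  have := subset_iter_image _ _ _ _ (ltn0Sn k) KLsub.
  suff -> : iter k.+1 (iter m (@shift_map X F)) = iter N (@shift_map X F) by [].
  by apply/funext => x; rewrite NE iterM.
have lastE x : last_coord (word x) = fst_coord (word (iter N (@shift_map X F) x)).
  by rewrite [RHS]iter_shift_mapE addn0.
exists (word @` K), (word @` L); split.
  split; [exact: cimg|exact: cimg|by exists (word a0), a0|by exists (word b0), b0|].
  apply/seteqP; split => // w [[x Kx xw] [z Lz zw]].
  have [i ik /eqP[]] := sep x z Kx Lz.
  have iN : (i < N.+1)%N by exact: ltn_trans ik (leqW kN).
  have xz : word x = word z by rewrite xw.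
  by have := congr1 (fun v => (set_val v : {ptws 'I_N.+1 -> X}) (Ordinal iN)) xz.
have fstP y : (K `|` L) y ->
    (@last_coord X F N @` (word @` K) `&` @last_coord X F N @` (word @` L))
      (fst_coord (word y)).
  move=> /KLN[[a Ka ay] [b Lb yb]]; split.
    by exists (word a); [exists a|rewrite lastE ay].
  by exists (word b); [exists b|rewrite lastE yb].
by move=> _ [] [_ [y Ay <-] <-]; apply: fstP; [left|right].
Qed.

Theorem theorem3p1 (R : realType) (X : metricType R) (F : set (X * X)) :
  compact [set: X] -> closed F ->
  (CR_turbulent F <->
   exists n : nat, (2 <= n)%N /\ separated_turbulent (iter (n - 1) (@shift_map X F))).
Proof.
move=> cX cF; split=> [/(CR_turbulent_shift F cX cF)[n n0 tn]|[n [n2 tn]]].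
  by exists n.+1; rewrite subn1.
apply: (shift_CR_turbulent F (n - 1)) tn => //; first exact: metric_hausdorff.
by rewrite subn_gt0.
Qed.
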